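(* Let $X,Y\subset\mathbb R^d$ be closed, $\Omega=X\times Y$, and let $\mu$ and $\nu$ be Borel probability measures on $X$ and $Y$, respectively. Then $$\mathfrak H_{ot}=\mathfrak B+\mathfrak C,\qquad \mathfrak K_{ot}=\mathfrak B+\mathfrak C+(\mathcal C_b'')_-=\mathfrak H_{ot}+(\mathcal C_b'')_- .$$ In particular, for every $\mathfrak a\in\mathcal C_b''$, $$\begin{aligned}\mathbf D(\mathfrak a;\mathfrak K_{ot})&=\mathbf D(\mathfrak a;\mathfrak B+\mathfrak C+(\mathcal C_b'')_-)\\&=\min\{c\in\mathbb R:\ \exists\,\mathfrak b\in\mathcal C_x'',\ \mathfrak c\in\mathcal C_y''\text{ with }\mathfrak b(\mu)=\mathfrak c(\nu)=0\text{ and }c\,\mathfrak I(\mathbf 1)+\mathfrak b\oplus\mathfrak c\ge\mathfrak a\}\\&=\sup_{\eta\in\mathcal Q_{ot}}\mathfrak a(\eta).\end{aligned}$$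
   Context: $\mathcal C_b=C_b(\Omega)$, $\mathcal C_x=C_b(X)$, $\mathcal C_y=C_b(Y)$ are the Banach lattices of bounded continuous real functions with the supremum norm; $\mathbf 1$ is the constant function $1$. Primes denote topological duals, ordered by duality; $(\cdot)_\pm$ denotes positive/negative elements; $\mathfrak I:\mathcal C_b\to\mathcal C_b''$ is the canonical embedding; $\mathcal H^\perp$ denotes the annihilator in the dual. For $h\in\mathcal C_x$, $g\in\mathcal C_y$: $(h\oplus g)(x,y)=h(x)+g(y)$. For $\eta\in\mathcal C_b'$ its marginals $\eta_x\in\mathcal C_x'$, $\eta_y\in\mathcal C_y'$ are $\eta_x(h)=\eta(h\oplus\mathbf 0)$, $\eta_y(g)=\eta(\mathbf 0\oplus g)$. For $\mathfrak b\in\mathcal C_x''$, $\mathfrak c\in\mathcal C_y''$, $\mathfrak b\oplus\mathfrak c\in\mathcal C_b''$ is given by $(\mathfrak b\oplus\mathfrak c)(\eta)=\mathfrak b(\eta_x)+\mathfrak c(\eta_y)$. Measures are identified with the functionals given by integration. $\mathcal H_{ot}=\{h\oplus g:h\in\mathcal C_x,\ g\in\mathcal C_y,\ \mu(h)=\nu(g)=0\}$. $\mathcal Q_{ot}=\{\eta\in(\mathcal C_b')_+:\eta(\mathbf 1)=1,\ \eta(f)=0\ \forall f\in\mathcal H_{ot}\}$. $\mathfrak H_{ot}=(\mathcal H_{ot}^\perp)^\perp\subset\mathcal C_b''$. $\mathfrak K_{ot}=\{\mathfrak z\in\mathcal C_b'':\mathfrak z(\eta)\le0\ \forall\eta\in\mathcal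 Q_{ot}\}$. $\mathfrak B=\{\mathfrak b\oplus\mathbf 0:\mathfrak b\in\mathcal C_x'',\ \mathfrak b(\mu)=0\}$ and $\mathfrak C=\{\mathbf 0\oplus\mathfrak c:\mathfrak c\in\mathcal C_y'',\ \mathfrak c(\nu)=0\}$. For $\mathfrak K\subset\mathcal C_b''$: $\mathbf D(\mathfrak a;\mathfrak K)=\inf\{c\in\mathbb R:\exists\,\mathfrak z\in\mathfrak K\text{ with }c\,\mathfrak I(\mathbf 1)+\mathfrak z=\mathfrak a\}$. *)

(* Defs.v *)
From HB Require Import structures.
From mathcomp Require Import all_boot all_order all_algebra.
From mathcomp Require Import all_classical all_reals all_analysis.

Set Implicit Arguments.
Unset Strict Implicit.
Unset Printing Implicit Defensive.
Import Order.TTheory GRing.Theory Num.Theory.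
Import numFieldNormedType.Exports.
Local Open Scope classical_set_scope.
Local Open Scope ring_scope.

(* sup of |f| over A; equal to 0 when A is empty, since sup set0 = 0 *)
Section sup_aux.
Variables (R : realType) (T : Type) (A : set T) (f : T -> R).

Definition supn : R := sup [set `|f x| | x in A].

Hypothesis fb : exists M, forall x, A x -> `|f x| <= M.

Lemma supn_ub x : A x -> `|f x| <= supn.
Proof.
move=> Ax; apply: ub_le_sup; last by exists x.
by have [M fM] := fb; exists M => _ [y Ay <-]; exact: fM.
Qed.

Lemma supn_ge0 : 0 <= supn.
Proof.
rewrite /supn; have [->|/set0P[_ [x Ax _]]] := eqVneq [set `|f x| | x in A] set0.
  by rewrite sup0.
exact: le_trans (normr_ge0 _) (supn_ub Ax).
Qed.

Lemma supn_le M : 0 <= M -> (forall x, A x -> `|f x| <= M) -> supn <= M.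
Proof.
move=> M0 fM.
rewrite /supn; have [->|/set0P nz] := eqVneq [set `|f x| | x in A] set0.
  by rewrite sup0.
by apply: ge_sup => // _ [x Ax <-]; exact: fM.
Qed.

End sup_aux.

Lemma supnZ (R : realType) (T : Type) (A : set T) (f : T -> R) (a : R) :
  (exists M, forall x, A x -> `|f x| <= M) ->
  supn A (fun x => a * f x) = `|a| * supn A f.
Proof.
move=> fb.
have le1 b g : (exists M, forall x, A x -> `|g x| <= M) ->
    supn A (fun x => b * g x) <= `|b| * supn A g.
  move=> gb; apply: supn_le => [|x Ax]; first by rewrite mulr_ge0 ?supn_ge0.
  by rewrite normrM ler_wpM2l// supn_ub.
apply/eqP; rewrite eq_le le1//=.
have [->|a0] := eqVneq a 0.
  rewrite normr0 mul0r supn_ge0//.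
  by exists 0 => x _; rewrite mul0r normr0.
rewrite -ler_pdivlMl ?normr_gt0// -normfV.
rewrite -[in leLHS](_ : (fun x => a^-1 * (a * f x)) = f).
  apply: le1; have [M fM] := fb; exists (`|a| * M) => x Ax.
  by rewrite normrM ler_wpM2l ?fM.
by apply/funext => x; rewrite mulKf.
Qed.

Section Cb.
Variables (R : realType) (T : topologicalType).

Definition Cb_pred : {pred T -> R^o} :=
  mem [set f : T -> R^o | continuous f /\ bounded_fun f].

Record Cb := MkCb { Cb_fun :> T -> R^o ; Cb_mem : Cb_fun \in Cb_pred }.

HB.instance Definition _ := [isSub for Cb_fun].
HB.instance Definition _ := [Choice of Cb by <:].

Lemma Cb_predP (f : T -> R^o) :
  f \in Cb_pred <-> continuous f /\ exists M, forall x, `|f x| <= M.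
Proof.
rewrite inE /=; split=> -[cf bf]; split=> //.
  by have /pinfty_ex_gt0[M _ fM] := bf; exists M => x; exact: fM.
have [M fM] := bf; rewrite /bounded_near; near=> N => x _; apply: (le_trans (fM x)).
by near: N; apply: nbhs_pinfty_ge; exact: num_real.
Unshelve. all: by end_near. Qed.

Lemma Cb_continuous (f : Cb) : continuous f.
Proof. by have /Cb_predP[] := Cb_mem f. Qed.

Lemma Cb_bounded (f : Cb) : exists M, forall x, [set: T] x -> `|f x| <= M.
Proof. by have /Cb_predP[_ [M fM]] := Cb_mem f; exists M. Qed.

Lemma Cb_submod : submod_closed Cb_pred.
Proof.
split=> [|a f g]; rewrite !Cb_predP.
  split; first exact: cst_continuous.
  by exists 0 => x; rewrite normr0.
move=> [cf [M fM]] [cg [N gN]]; split.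
  by move=> x; apply: continuousD; [apply: continuousZr; exact: cf|exact: cg].
exists (`|a| * M + N) => x.
rewrite (le_trans (ler_normD _ _))// lerD ?gN//.
by rewrite normrZ ler_wpM2l.
Qed.

HB.instance Definition _ :=
  GRing.isSubmodClosed.Build R (T -> R^o) Cb_pred Cb_submod.
HB.instance Definition _ := [SubChoice_isSubLmodule of Cb by <:].

Definition Cb_norm (f : Cb) : R := supn [set: T] f.

Lemma Cb_normD (f g : Cb) : Cb_norm (f + g) <= Cb_norm f + Cb_norm g.
Proof.
have [fb gb] := (Cb_bounded f, Cb_bounded g).
apply: supn_le => [|x _]; first by rewrite addr_ge0 ?supn_ge0.
by rewrite (le_trans (ler_normD _ _))// lerD// (supn_ub _ (A := setT)).
Qed.

Lemma Cb_normZ (a : R) (f : Cb) : Cb_norm (a *: f) = `|a| * Cb_norm f.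
Proof. by apply: supnZ; exact: Cb_bounded. Qed.

Lemma Cb_norm_eq0 (f : Cb) : Cb_norm f = 0 -> f = 0.
Proof.
move=> f0; apply/val_inj/funext => x; apply/eqP.
by rewrite -normr_le0 -f0 (supn_ub (Cb_bounded f)).
Qed.

HB.instance Definition _ :=
  Lmodule_isNormed.Build R Cb Cb_normD Cb_normZ Cb_norm_eq0.

Lemma Cb_cst_mem (c : R) : (fun=> c) \in Cb_pred.
Proof.
by apply/Cb_predP; split; [exact: cst_continuous|exists `|c|].
Qed.

Definition Cb_cst (c : R) : Cb := MkCb (Cb_cst_mem c).

Definition Cb_pos : set Cb := [set f | forall x, 0 <= (f x : R)].

End Cb.

Section dual.
Variables (R : realType) (E : normedModType R).

Definition dual_pred : {pred E -> R^o} :=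
  mem [set l : E -> R^o | linear l /\ continuous l].

Record dual := MkDual { dual_fun :> E -> R^o ; dual_mem : dual_fun \in dual_pred }.

HB.instance Definition _ := [isSub for dual_fun].
HB.instance Definition _ := [Choice of dual by <:].

Lemma dual_linear (l : dual) : linear l.
Proof. by have := dual_mem l; rewrite inE => -[]. Qed.

HB.instance Definition _ (l : dual) :=
  GRing.isLinear.Build R E R^o _ l (dual_linear l).

Lemma dual_continuous (l : dual) : continuous l.
Proof. by have := dual_mem l; rewrite inE => -[]. Qed.

Lemma dual_predI (l : E -> R^o) : linear l ->
  (exists M, forall x, `|l x| <= M * `|x|) -> l \in dual_pred.
Proof.
move=> ll [M lM]; rewrite inE; split=> //.
pose h := GRing.isLinear.Build R E R^o _ l ll.
pose L : {linear E -> R^o} := HB.pack l h.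
apply: (@bounded_linear_continuous _ _ _ L); apply/linear_boundedP.
near=> r => x; rewrite (le_trans (lM x))// ler_wpM2r//.
Unshelve. all: by end_near. Qed.

Lemma dual_bounded (l : dual) :
  exists M, forall x, [set x | `|x| <= 1] x -> `|l x| <= M.
Proof.
have /linear_boundedP : bounded_near l (nbhs (0 : E)).
  by apply: continuous_linear_bounded; exact: dual_continuous.
move=> /pinfty_ex_gt0[M M0 lM]; exists M => x /= x1.
by rewrite (le_trans (lM x))// ler_piMr// ltW.
Qed.

Lemma dual_submod : submod_closed dual_pred.
Proof.
split=> [|a l k]; rewrite !inE.
  split; last exact: cst_continuous.
  by move=> b x y; rewrite /= scaler0 addr0.
move=> [ll cl] [lk ck]; split=> [b x y|x].
  by rewrite !fctE ll lk !scalerDr !scalerA mulrC addrACA.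
by apply: continuousD; [apply: continuousZr; exact: cl|exact: ck].
Qed.

HB.instance Definition _ :=
  GRing.isSubmodClosed.Build R (E -> R^o) dual_pred dual_submod.
HB.instance Definition _ := [SubChoice_isSubLmodule of dual by <:].

Definition dual_norm (l : dual) : R := supn [set x | `|x| <= 1] l.

Lemma dual_norm_le (l : dual) x : `|l x| <= dual_norm l * `|x|.
Proof.
have [->|x0] := eqVneq x 0; first by rewrite linear0 !normr0 mulr0.
have nx : 0 < `|x| by rewrite normr_gt0.
rewrite -ler_pdivrMr// -[X in _ / X]normr_id mulrC -normfV -normrZ -linearZ.
apply: (supn_ub (dual_bounded l)) => /=.
by rewrite normrZ normfV normr_id mulVf ?gt_eqF.
Qed.

Lemma dual_normD (l k : dual) : dual_norm (l + k) <= dual_norm l + dual_norm k.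
Proof.
have [lb kb] := (dual_bounded l, dual_bounded k).
apply: supn_le => [|x x1]; first by rewrite addr_ge0 ?supn_ge0.
by rewrite (le_trans (ler_normD _ _))// lerD// (supn_ub _ (A := [set x | _])).
Qed.

Lemma dual_normZ (a : R) (l : dual) : dual_norm (a *: l) = `|a| * dual_norm l.
Proof. by apply: supnZ; exact: dual_bounded. Qed.

Lemma dual_norm_eq0 (l : dual) : dual_norm l = 0 -> l = 0.
Proof.
move=> l0; apply/val_inj/funext => x; apply/eqP.
by rewrite -normr_le0 (le_trans (dual_norm_le l x))// l0 mul0r.
Qed.

HB.instance Definition _ :=
  Lmodule_isNormed.Build R dual dual_normD dual_normZ dual_norm_eq0.

Lemma dual_le (l : dual) x : `|l x| <= `|l| * `|x|.
Proof. exact: dual_norm_le. Qed.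

Definition dual_cone (P : set E) : set dual :=
  [set l | forall x, P x -> 0 <= (l x : R)].

Definition annihilator (H : set E) : set dual :=
  [set l | forall x, H x -> l x = 0].

End dual.

Notation bidual E := (dual (dual E)).

Section bidual_embed.
Variables (R : realType) (E : normedModType R).

Lemma bidual_embed_mem (x : E) : (fun l : dual E => l x) \in @dual_pred R (dual E).
Proof. by apply: dual_predI => //; exists `|x| => l; rewrite mulrC dual_le. Qed.

Definition bidual_embed (x : E) : bidual E := MkDual (bidual_embed_mem x).

End bidual_embed.

Definition borel (T : ptopologicalType) : measurableType (sigma_display (@open T)) :=
  [the measurableType _ of g_sigma_algebraType (@open T)].

Section integral_functional.
Variables (R : realType) (T : ptopologicalType) (mu : probability (borel T) R).

Lemma Cb_measurable (f : Cb R T) : measurable_fun [set: borel T] (f : borel T -> R).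
Proof.
apply: (measurability _ (measurable_realfun.RGenOpens.measurableE R)).
move=> _ [_ [a [b ->] <-]]; rewrite setTI; apply: sub_sigma_algebra => /=.
by apply: open_comp; [move=> x _; exact: Cb_continuous|exact: interval_open].
Qed.

Lemma Cb_integrable (f : Cb R T) : mu.-integrable [set: borel T] (EFin \o f).
Proof.
apply: measurable_bounded_integrable => //.
- by rewrite [X in (X < _)%E](probability_setT mu) ltry.
- exact: Cb_measurable.
- by have := Cb_mem f; rewrite inE => -[].
Qed.

Lemma integral_mem :
  (fun f : Cb R T => \int[mu]_x (f x : R)) \in @dual_pred R (Cb R T).
Proof.
apply: dual_predI => [a f g|].
  change (\int[mu]_x (a * (f x : R) + (g x : R)) =
          a * \int[mu]_x (f x : R) + \int[mu]_x (g x : R) :> R).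
  rewrite -RintegralZl//; last exact: Cb_integrable.
  rewrite -RintegralD//; last exact: Cb_integrable.
  exact: (Cb_integrable (a *: f)).
exists 1 => f; rewrite mul1r.
rewrite (le_trans (le_normr_Rintegral _ _))//; first exact: Cb_integrable.
apply: le_trans (_ : \int[mu]_x (cst `|f| x) <= _).
  apply: le_Rintegral => //.
  - by apply: integrable_norm => //; exact: Cb_integrable.
  - exact: (Cb_integrable (Cb_cst T `|f|)).
  - by move=> x _; exact: (supn_ub (Cb_bounded f)).
by rewrite Rintegral_cst// [X in fine X](probability_setT mu) mulr1.
Qed.

Definition integral_dual : dual (Cb R T) := MkDual integral_mem.

End integral_functional.

Section marginals.
Variables (R : realType) (S T : topologicalType).

Lemma oplus_mem (h : Cb R S) (g : Cb R T) :
  (fun z : S * T => h z.1 + g z.2) \in @Cb_pred R (S * T)%type.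
Proof.
apply/Cb_predP; split.
  move=> z; apply: (@continuousD _ _ _ (h \o fst) (g \o snd)).
    by apply: continuous_comp; [exact: cvg_fst|exact: Cb_continuous].
  by apply: continuous_comp; [exact: cvg_snd|exact: Cb_continuous].
exists (`|h| + `|g|) => z; rewrite (le_trans (ler_normD _ _))// lerD//.
  exact: (supn_ub (Cb_bounded h)).
exact: (supn_ub (Cb_bounded g)).
Qed.

Definition oplus h g : Cb R (S * T)%type := MkCb (oplus_mem h g).

Lemma oplusP a h h' g g' :
  oplus (a *: h + h') (a *: g + g') = a *: oplus h g + oplus h' g'.
Proof.
apply/val_inj/funext => z /=; rewrite !fctE /=.
by rewrite scalerDr addrACA.
Qed.

Lemma oplus_norm h g : `|oplus h g| <= `|h| + `|g|.
Proof.
apply: supn_le => [|z _]; first by rewrite addr_ge0.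
rewrite (le_trans (ler_normD _ _))// lerD//.
  exact: (supn_ub (Cb_bounded h)).
exact: (supn_ub (Cb_bounded g)).
Qed.

Implicit Type eta : dual (Cb R (S * T)%type).

Lemma marg1_mem eta : (fun h => eta (oplus h 0)) \in @dual_pred R (Cb R S).
Proof.
apply: dual_predI => [a h h'|].
  by rewrite -linearP -oplusP scaler0 addr0.
exists `|eta| => h; rewrite (le_trans (dual_le _ _))// ler_wpM2l//.
by rewrite (le_trans (oplus_norm _ _))// normr0 addr0.
Qed.

Lemma marg2_mem eta : (fun g => eta (oplus 0 g)) \in @dual_pred R (Cb R T).
Proof.
apply: dual_predI => [a g g'|].
  by rewrite -linearP -oplusP scaler0 addr0.
exists `|eta| => g; rewrite (le_trans (dual_le _ _))// ler_wpM2l//.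
by rewrite (le_trans (oplus_norm _ _))// normr0 add0r.
Qed.

Definition marg1 eta : dual (Cb R S) := MkDual (marg1_mem eta).
Definition marg2 eta : dual (Cb R T) := MkDual (marg2_mem eta).

Lemma marg1_norm eta : `|marg1 eta| <= `|eta|.
Proof.
apply: supn_le => // h h1; rewrite (le_trans (dual_le eta _))// ler_piMr//.
by rewrite (le_trans (oplus_norm _ _))// normr0 addr0.
Qed.

Lemma marg2_norm eta : `|marg2 eta| <= `|eta|.
Proof.
apply: supn_le => // g g1; rewrite (le_trans (dual_le eta _))// ler_piMr//.
by rewrite (le_trans (oplus_norm _ _))// normr0 add0r.
Qed.

Lemma marg1P : linear marg1.
Proof. by move=> a eta eta'; apply/val_inj/funext. Qed.

Lemma marg2P : linear marg2.
Proof. by move=> a eta eta'; apply/val_inj/funext. Qed.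

Lemma bioplus_mem (b : bidual (Cb R S)) (c : bidual (Cb R T)) :
  (fun eta => b (marg1 eta) + c (marg2 eta))
    \in @dual_pred R (dual (Cb R (S * T)%type)).
Proof.
apply: dual_predI => [a eta eta'|].
  by rewrite marg1P marg2P !linearP scalerDr addrACA.
exists (`|b| + `|c|) => eta; rewrite (le_trans (ler_normD _ _))// mulrDl lerD//.
  by rewrite (le_trans (dual_le _ _))// ler_wpM2l// marg1_norm.
by rewrite (le_trans (dual_le _ _))// ler_wpM2l// marg2_norm.
Qed.

Definition bioplus b c : bidual (Cb R (S * T)%type) := MkDual (bioplus_mem b c).

End marginals.

Definition Minkowski_sum (V : zmodType) (A B : set V) : set V :=
  [set a + b | a in A & b in B].

Definition is_minimum (R : realType) (A : set R) (m : R) : Prop :=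
  A m /\ lbound A m.

Section order.
Variables (R : realType) (U : topologicalType).

Definition one : Cb R U := Cb_cst U 1.

Definition dual_pos : set (dual (Cb R U)) := dual_cone (@Cb_pos R U).

Definition bidual_pos : set (bidual (Cb R U)) := dual_cone dual_pos.

Definition bidual_neg : set (bidual (Cb R U)) := [set z | bidual_pos (- z)].

Definition bidual_le (a b : bidual (Cb R U)) : Prop := bidual_pos (b - a).

(* The infimum is taken in [-oo, +oo]; it is +oo when there is no such c. *)
Definition D_inf (a : bidual (Cb R U)) (K : set (bidual (Cb R U))) : \bar R :=
  ereal_inf [set c%:E | c in
    [set c : R | exists2 z, K z & c *: bidual_embed one + z = a]].

End order.
Arguments one {R U}.
Arguments dual_pos {R U}.
Arguments bidual_pos {R U}.
Arguments bidual_neg {R U}.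

Section optimal_transport.
Variables (R : realType) (S T : ptopologicalType).
Variables (mu : probability (borel S) R) (nu : probability (borel T) R).

Local Notation Cx := (Cb R S).
Local Notation Cy := (Cb R T).
Local Notation C := (Cb R (S * T)%type).

Definition H_ot : set C :=
  [set f | exists h g,
    [/\ integral_dual mu h = 0, integral_dual nu g = 0 & f = oplus h g]].

Definition Q_ot : set (dual C) :=
  [set eta | [/\ dual_pos eta, eta one = 1 & forall f, H_ot f -> eta f = 0]].

Definition frakH_ot : set (bidual C) := annihilator (annihilator H_ot).

Definition frakK_ot : set (bidual C) :=
  [set z | forall eta, Q_ot eta -> (z eta : R) <= 0].

Definition frakB : set (bidual C) :=
  [set bioplus b 0 | b in [set b : bidual Cx | b (integral_dual mu) = 0]].

Definition frakC : set (bidual C) :=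
  [set bioplus 0 c | c in [set c : bidual Cy | c (integral_dual nu) = 0]].

Definition dual_values (a : bidual C) : set R :=
  [set c | exists (b : bidual Cx) (c' : bidual Cy),
    [/\ b (integral_dual mu) = 0, c' (integral_dual nu) = 0
      & bidual_le a (c *: bidual_embed one + bioplus b c')]].

End optimal_transport.

(* The subspace A as a topological type.  Nonemptiness is required because
   measurable types of the library are pointed; it costs nothing here, since
   there is no probability measure on the empty set. *)
Definition subspace_of (T : topologicalType) (A : set T) (A0 : A !=set0) : Type :=
  A.

Section subspace_of.
Variables (T : topologicalType) (A : set T) (A0 : A !=set0).

HB.instance Definition _ := Topological.copy (subspace_of A0) (set_type A).
HB.instance Definition _ := isPointed.Build (subspace_of A0)
  (exist _ (sval (cid A0)) (mem_set (svalP (cid A0)))).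

End subspace_of.

(* Main.v *)
Require Import Defs.
From HB Require Import structures.
From mathcomp Require Import all_boot all_order all_algebra.
From mathcomp Require Import all_classical all_reals all_analysis.
From mathcomp Require Import ring lra.

Set Implicit Arguments.
Unset Strict Implicit.
Unset Printing Implicit Defensive.
Import Order.TTheory GRing.Theory Num.Theory.
Import numFieldNormedType.Exports.
Local Open Scope classical_set_scope.
Local Open Scope ring_scope.

(** The inclusions of frakB + frakC + (C_b'')_- in frakK_ot and of
    frakB + frakC in frakH_ot are computations with marginals; the reverse ones
    carry the content. Let N be the annihilator in C_b' of the set H_ot of
    functions. A functional eta lies in N exactly when its marginals are
    eta(1) mu and eta(1) nu ([annihilator_HotP]).

    For frakH_ot = frakB + frakC, fix a point (x, y) and correct an arbitrary
    eta by functionals of the form (alpha tensor delta_y) and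
    (delta_x tensor beta) so that both marginals vanish ([Hperp_residual]). The
    result is in N, so an element z of frakH_ot kills it, which expresses z(eta)
    through the two marginals of eta; the constants are then adjusted
    ([frakH_decomposition]).

    For frakK_ot = frakB + frakC + (C_b'')_-, let z be nonpositive on Q_ot. It
    is enough to find l in frakH_ot with l >= z on the positive functionals. The
    Hahn-Banach theorem yields a bounded l as soon as z(eta) <= K |eta - n| for
    all eta >= 0 and all n in N ([frakK_bound], [frakK_majorant]). This
    estimate is the heart of the matter: a positive functional at distance e
    from some n in N with n(1) >= 0 can be replaced by a positive element of N
    at distance at most 3 e ([coupling_repair]). A second application of
    Hahn-Banach, this time on C_b, reduces that repair to an inequality for
    dominated sums h (+) g <= u, and there one may first normalise and clip h
    and g so that |h (+) g| <= 3 |u| ([oplus_dominated]).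

    Applied to the zero functional the repair also shows that Q_ot is
    nonempty, hence m = sup of a(eta) over Q_ot is a real number. Then
    a - m I(1) lies in frakK_ot, and the decomposition of frakK_ot provides the
    minimisers. *)

Local Notation one := Defs.one.

(** * Linear minorants of convex cones *)

Section convex_cones.
Variable R : realType.

Definition convex_cone (W : lmodType R) (G : set W) : Prop :=
  (forall (k : R) w, 0 <= k -> G w -> G (k *: w)) /\
  (forall v w, G v -> G w -> G (v + w)).

(** Hahn-Banach theorem in the form used below: the cone G plays the role of
    the epigraph of a sublinear function, but may be given by any generators,
    so that no infimum has to be computed to apply it. In a maximal proper
    cone M containing G, whenever (v, r) is missing some point below (- v, - r)
    is present; therefore the lower boundary of M is odd, and an odd sublinear
    function is linear. *)
Lemma cone_minorant (V : lmodType R) (G : set (V * R^o)) :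
  convex_cone G -> (forall v, exists r, G (v, r)) ->
  (forall r : R, G (0, r) -> 0 <= r) ->
  exists2 L : V -> R^o, linear L & forall v (r : R), G (v, r) -> L v <= r.
Proof.
move=> coneG totG propG.
pose proper (K : set (V * R^o)) := convex_cone K /\ forall r : R, K (0, r) -> 0 <= r.
(* Zorn is applied to sets A such that A `|` G is proper, so that the empty
   chain causes no exception *)
have [F chF totF|A [[[AZ AD] A0] maxA]] := @Zorn_bigcup _ (fun A => proper (A `|` G)).
  have cmp x y : (\bigcup_(K in F) K `|` G) x -> (\bigcup_(K in F) K `|` G) y ->
      exists K, [/\ (K = set0 \/ F K), (K `|` G) x & (K `|` G) y].
    move=> [[K FK Kx]|Gx] [[K' FK' Ky]|Gy].
    - by have [KK|KK] := totF _ _ FK FK'; [exists K'|exists K]; split;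
        by [right|left; apply: KK|left].
    - by exists K; split; [right|left|right].
    - by exists K'; split; [right|right|left].
    - by exists set0; split; [left|right|right].
  have good K : K = set0 \/ F K -> proper (K `|` G).
    by move=> [->|/chF//]; rewrite set0U.
  have up K w : K = set0 \/ F K -> (K `|` G) w -> (\bigcup_(K in F) K `|` G) w.
    by move=> [->|FK] [Kw|Gw]; [|right|left; exists K|right].
  split; first split=> [k w k0 Fw|v w Fv Fw].
  - have [K [FK Kw _]] := cmp _ _ Fw Fw.
    by apply: (up K) => //; have [[KZ _] _] := good _ FK; exact: KZ.
  - have [K [FK Kv Kw]] := cmp _ _ Fv Fw.
    by apply: (up K) => //; have [[_ KD] _] := good _ FK; exact: KD.
  - move=> r Fr; have [K [FK Kr _]] := cmp _ _ Fr Fr.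
    by have [_] := good _ FK; apply.
set M := A `|` G in AZ AD A0.
have M0 : M 0.
  by have [r Gr] := totG 0; have := AZ 0 _ (lexx 0) (or_intror Gr); rewrite scale0r.
(* a point that cannot be added to M is excluded by an opposite point of M *)
have dich v (r : R) : M (v, r) \/ exists2 s : R, M (- v, s) & s < - r.
  apply: contrapT => /not_orP[nM nopp]; pose B : set (V * R^o) :=
    [set w | exists k : R, exists2 m, 0 <= k & M m /\ w = k *: (v, r : R^o) + m].
  have MB : M `<=` B by move=> m Mm; exists 0, m; rewrite ?scale0r ?add0r.
  have Bvr : B (v, r) by exists 1, 0; rewrite ?scale1r ?addr0.
  have BG : B `|` G = B.
    by apply/seteqP; split=> [w [//|Gw]|w]; [apply: MB; right|left].
  apply: (maxA B).
    split=> [w Aw|BA]; first by apply: MB; left.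
    by apply: nM; left; apply: BA.
  rewrite BG; split; first split.
  - move=> k w k0 [j [m j0 [Mm ->]]]; exists (k * j), (k *: m); first exact: mulr_ge0.
    by split; [exact: AZ|rewrite scalerDr scalerA].
  - move=> w w' [j [m j0 [Mm ->]]] [j' [m' j'0 [Mm' ->]]].
    exists (j + j'), (m + m'); first exact: addr_ge0.
    by split; [exact: AD|rewrite scalerDl addrACA].
  - move=> s [k [[m1 m2] k0 [Mm [e1 e2]]]].
    have [k00|kn0] := eqVneq k 0.
      move: e1 e2; rewrite k00 !scale0r !add0r => e1 e2.
      by apply: A0; rewrite e1 e2.
    have kp : 0 < k by rewrite lt_def kn0.
    rewrite leNgt; apply/negP => s0; apply: nopp; exists (k^-1 * m2).
      have := AZ k^-1 _ (ltW _) Mm; rewrite invr_gt0 => /(_ kp).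
      suff -> : - v = k^-1 *: m1 by [].
      by apply: (scalerI kn0); rewrite scalerA divff// scale1r scalerN;
         apply/esym/eqP; rewrite -addr_eq0 addrC -e1.
    rewrite -ltr_pdivlMl ?invr_gt0// invrK mulrN -subr_gt0 -opprD oppr_gt0.
    by move: s0; rewrite e2 addrC.
pose U v := [set r : R | M (v, r : R^o)].
have Uinf v : has_inf (U v).
  split; first by have [r Gr] := totG v; exists r; right.
  have [s Gs] := totG (- v); exists (- s) => r Ur.
  rewrite -subr_ge0 opprK; apply: A0.
  by have := AD _ _ Ur (or_intror Gs); rewrite -[_ + _]/(v - v, r + s) subrr.
pose L v := inf (U v).
have LG v (r : R) : M (v, r) -> L v <= r.
  by move=> Mr; apply: ge_inf => //; exact: (Uinf v).2.
have Lge v (r : R) : (forall s : R, M (v, s) -> r <= s) -> r <= L v.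
  by move=> rM; apply: lb_le_inf; [exact: (Uinf v).1|move=> s; exact: rM].
have LD v w : L (v + w) <= L v + L w.
  rewrite -lerBlDr; apply: (Lge) => r Mr; rewrite lerBlDr -lerBlDl.
  apply: (Lge) => s Ms; rewrite lerBlDl; apply: LG; exact: (AD _ _ Mr Ms).
have LN v : L (- v) <= - L v.
  apply/ler_addgt0Pl => e e0.
  have [/LG|[s Ms sr]] := dich v (L v - e); first by rewrite lerBrDr gerDl leNgt e0.
  by apply: (le_trans (LG _ _ Ms)); rewrite (le_trans (ltW sr))// opprB.
have L0 : L 0 = 0 by apply: le_anti; rewrite LG//=; exact: Lge.
have LNE v : L (- v) = - L v.
  by apply: le_anti; rewrite LN/= -subr_ge0 opprK addrC -L0 -{1}(subrr v) LD.
have LDE v w : L (v + w) = L v + L w.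
  apply: le_anti; rewrite LD/= -lerBrDr -LNE -{1}(addrK w v); exact: LD.
have LZle (k : R) v : 0 < k -> L (k *: v) <= k * L v.
  move=> k0; rewrite -ler_pdivrMl//; apply: (Lge) => r Mr.
  by rewrite ler_pdivrMl//; apply: LG; exact: (AZ _ _ (ltW k0) Mr).
have LZ (k : R) v : L (k *: v) = k * L v.
  have pos (j : R) w : 0 < j -> L (j *: w) = j * L w.
    move=> j0; apply: le_anti; rewrite LZle//= -ler_pdivlMl//.
    rewrite (le_trans _ (LZle _ _ _)) ?invr_gt0//.
    by rewrite scalerA mulVf ?gt_eqF// scale1r.
  have [k0|k0|->] := ltgtP k 0; [|exact: pos|by rewrite scale0r mul0r L0].
  by rewrite -[k]opprK scaleNr LNE pos ?oppr_gt0// !mulNr.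
exists L => [k v w|v r Gr]; first by rewrite LDE LZ.
by apply: LG; right.
Qed.

(** The bound r <= K |v| turns domination by the cone into continuity. *)
Lemma dual_minorant (E : normedModType R) (G : set (E * R^o)) (K : R) :
  convex_cone G ->
  (forall v, exists2 r : R, G (v, r : R^o) & r <= K * `|v|) ->
  (forall r : R, G (0, r) -> 0 <= r) ->
  exists l : dual E, forall v (r : R), G (v, r) -> l v <= r.
Proof.
move=> coneG bG propG.
have [v|L lL LG] := cone_minorant coneG _ propG.
  by have [r Gr _] := bG v; exists r.
pose h := GRing.isLinear.Build R E R^o _ L lL.
pose L' : {linear E -> R^o} := HB.pack L h.
suff Lm : L \in @dual_pred R E by exists (MkDual Lm).
apply: dual_predI => //; exists K => v.
have LK w : L w <= K * `|w|.
  by have [r Gr rK] := bG w; rewrite (le_trans (LG _ _ Gr)).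
have := LK (- v); rewrite normrN -[L (- v)]/(L' (- v)) linearN => LNv.
by rewrite ler_norml LK andbT lerNl.
Qed.

End convex_cones.

(** * Adjoints, positive functionals and push-forwards *)

Section adjoint.
Variables (R : realType) (E F : normedModType R) (A : E -> F).
Hypotheses (linA : linear A) (contrA : forall x, `|A x| <= `|x|).

Lemma adjoint_mem (l : dual F) : (fun x => l (A x)) \in @dual_pred R E.
Proof.
apply: dual_predI => [k x y|]; first by rewrite linA linearP.
by exists `|l| => x; rewrite (le_trans (dual_le _ _))// ler_wpM2l.
Qed.

Definition adjoint (l : dual F) : dual E := MkDual (adjoint_mem l).

Lemma adjoint_linear : linear adjoint.
Proof. by move=> k l l'; apply/val_inj/funext. Qed.

Lemma adjoint_contraction l : `|adjoint l| <= `|l|.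
Proof.
apply: supn_le => // x x1; rewrite (le_trans (dual_le l _))// ler_piMr//.
by rewrite (le_trans (contrA x)).
Qed.

End adjoint.

(** Linearity stated for the bare function underlying a functional, so that
    later rewriting recognises the applications that it produces. *)
Section dual_arithmetic.
Variables (R : realType) (E : normedModType R).
Implicit Types (l k : dual E) (x y : E).

Lemma dual0 l : l 0 = 0. Proof. exact: linear0. Qed.
Lemma dualD l x y : l (x + y) = l x + l y. Proof. exact: linearD. Qed.
Lemma dualN l x : l (- x) = - l x. Proof. exact: linearN. Qed.
Lemma dualB l x y : l (x - y) = l x - l y. Proof. exact: linearB. Qed.
Lemma dualZ l (a : R) x : l (a *: x) = a * l x. Proof. exact: linearZ. Qed.
Lemma dualDE l k x : (l + k) x = l x + k x. Proof. by []. Qed.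
Lemma dualNE l x : (- l) x = - l x. Proof. by []. Qed.
Lemma dualZE (a : R) l x : (a *: l) x = a * l x. Proof. by []. Qed.

End dual_arithmetic.

Section bounded_functions.
Variables (R : realType) (U : topologicalType).
Implicit Types (f g : Cb R U) (eta : dual (Cb R U)).

Lemma Cb_le_norm f x : `|f x : R| <= `|f|.
Proof. exact: (supn_ub (Cb_bounded f)). Qed.

Lemma Cb_norm_le f (M : R) : 0 <= M -> (forall x, `|f x : R| <= M) -> `|f| <= M.
Proof. by move=> M0 fM; apply: supn_le. Qed.

Lemma CbDE f g x : (f + g) x = f x + g x. Proof. by []. Qed.
Lemma CbNE f x : (- f) x = - f x. Proof. by []. Qed.
Lemma CbZE (k : R) f x : (k *: f) x = k * f x. Proof. by []. Qed.

Lemma dual_pos_le eta f g : dual_pos eta ->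
  (forall x, (f x : R) <= g x) -> (eta f : R) <= eta g.
Proof.
move=> eta0 fg; rewrite -subr_ge0 -dualB.
by apply: eta0 => x; rewrite CbDE CbNE subr_ge0.
Qed.

(** The values on the unit ball lie between those at - 1 and 1. *)
Lemma dual_pos_norm eta : dual_pos eta -> `|eta| <= (eta one : R).
Proof.
move=> eta0.
have e1 : (0 : R) <= eta one by apply: eta0 => x /=; exact: ler01.
apply: supn_le => // f /= f1.
have e k : eta (k *: one) = k * eta one by rewrite dualZ.
rewrite ler_norml; apply/andP; split.
  rewrite -mulN1r -e; apply: dual_pos_le => // x.
  rewrite CbZE mulr1; have := Cb_le_norm f x.
  by rewrite ler_norml => /andP[+ _]; apply: le_trans; rewrite lerN2.
apply: dual_pos_le => // x.
have := Cb_le_norm f x; rewrite ler_norml => /andP[_ /le_trans]; exact.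
Qed.

Lemma clip_mem f (k : R) : (fun x => Num.max (f x : R) k) \in @Cb_pred R U.
Proof.
apply/Cb_predP; split.
  move=> x; apply: (@continuous_max _ _ f (fun=> k)); last exact: cst_continuous.
  exact: Cb_continuous.
exists (`|f| + `|k|) => x; rewrite /Num.max; case: ifP => _.
  by rewrite ler_wpDl.
by rewrite (le_trans (Cb_le_norm f x))// ler_wpDr.
Qed.

Definition clip f k : Cb R U := MkCb (clip_mem f k).

Lemma point_eval_mem (x : U) : (fun f : Cb R U => f x) \in @dual_pred R (Cb R U).
Proof. by apply: dual_predI => //; exists 1 => f; rewrite mul1r Cb_le_norm. Qed.

Definition point_eval (x : U) : dual (Cb R U) := MkDual (point_eval_mem x).

End bounded_functions.

Section pullback.
Variables (R : realType) (U V : topologicalType) (phi : U -> V).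
Hypothesis cphi : continuous phi.

Lemma pullback_mem (f : Cb R V) : (fun x => f (phi x)) \in @Cb_pred R U.
Proof.
apply/Cb_predP; split; last by exists `|f| => x; exact: Cb_le_norm.
by move=> x; apply: continuous_comp; [exact: cphi|exact: Cb_continuous].
Qed.

Definition pullback (f : Cb R V) : Cb R U := MkCb (pullback_mem f).

Lemma pullback_linear : linear pullback.
Proof. by move=> k f g; apply/val_inj/funext. Qed.

Lemma pullback_contraction f : `|pullback f| <= `|f|.
Proof. by apply: Cb_norm_le => // x; exact: (Cb_le_norm f). Qed.

(** On a measure this is the image measure under phi. *)
Definition pushforward : dual (Cb R U) -> dual (Cb R V) :=
  adjoint pullback_linear pullback_contraction.

Lemma pushforward_linear : linear pushforward.
Proof. exact: adjoint_linear. Qed.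

Lemma pushforward_contraction a : `|pushforward a| <= `|a|.
Proof. exact: adjoint_contraction. Qed.

End pullback.

(** * Marginals and the annihilator of H_ot *)

Section probability_functional.
Variables (R : realType) (T : ptopologicalType) (mu : probability (borel T) R).

Lemma integral_dual_one : integral_dual mu one = 1.
Proof.
rewrite [LHS](_ : _ = \int[mu]_x (cst 1 x : R))//.
by rewrite Rintegral_cst// [X in fine X](probability_setT mu) mulr1.
Qed.

Lemma integral_dual_pos : dual_pos (integral_dual mu).
Proof. by move=> f f0; apply: Rintegral_ge0 => x _; exact: f0. Qed.

End probability_functional.

Section optimal_transport.
Variables (R : realType) (S T : ptopologicalType).
Variables (mu : probability (borel S) R) (nu : probability (borel T) R).

Local Notation Cx := (Cb R S).
Local Notation Cy := (Cb R T).
Local Notation C := (Cb R (S * T)%type).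
Local Notation mu' := (integral_dual mu).
Local Notation nu' := (integral_dual nu).
Local Notation Hperp := (annihilator (H_ot mu nu)).

Implicit Types (h : Cx) (g : Cy) (eta : dual C).

Lemma oplusD h h' g g' : oplus (h + h') (g + g') = oplus h g + oplus h' g'.
Proof. by have := oplusP 1 h h' g g'; rewrite !scale1r. Qed.

Lemma oplus0 : oplus 0 0 = 0 :> C.
Proof. by apply/val_inj/funext => z; rewrite -[LHS]/(0 + 0 : R) addr0. Qed.

Lemma oplusZ (k : R) h g : oplus (k *: h) (k *: g) = k *: oplus h g.
Proof. by have := oplusP k h 0 g 0; rewrite !addr0 oplus0 addr0. Qed.

Lemma oplusN h g : oplus (- h) (- g) = - oplus h g.
Proof. by rewrite -(scaleN1r h) -(scaleN1r g) oplusZ scaleN1r. Qed.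

Lemma marginalsE eta h g : eta (oplus h g) = marg1 eta h + marg2 eta g.
Proof.
rewrite -[RHS]/(eta (oplus h 0) + eta (oplus 0 g)) -dualD.
by congr (eta _); apply/val_inj/funext => z /=; rewrite !fctE /= addr0 add0r.
Qed.

Lemma marg1_one eta : marg1 eta one = eta one.
Proof.
by congr (eta _); apply/val_inj/funext => z /=; rewrite addr0.
Qed.

Lemma marg2_one eta : marg2 eta one = eta one.
Proof.
by congr (eta _); apply/val_inj/funext => z /=; rewrite add0r.
Qed.

(** Taking g = 0 or h = 0 recovers each marginal. *)
Lemma marginals_eq eta (a : dual Cx) (b : dual Cy) :
  (forall h g, eta (oplus h g) = a h + b g) -> marg1 eta = a /\ marg2 eta = b.
Proof.
by move=> e; split; apply/val_inj/funext => f /=; rewrite e dual0 ?addr0 ?add0r.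
Qed.

(** Subtracting mu(h) from h and nu(g) from g puts h (+) g in H_ot up to the
    constant mu(h) + nu(g). *)
Lemma annihilator_HotP eta :
  Hperp eta <-> forall h g, eta (oplus h g) = eta one * (mu' h + nu' g).
Proof.
split=> [eH h g|e f [h [g [h0 g0 ->]]]]; last by rewrite e h0 g0 addr0 mulr0.
have -> : oplus h g =
    oplus (h - mu' h *: one) (g - nu' g *: one) + (mu' h + nu' g) *: one.
  apply/val_inj/funext => z; rewrite -[LHS]/(h z.1 + g z.2 : R).
  rewrite -[RHS]/((h z.1 - mu' h * 1) + (g z.2 - nu' g * 1) + (mu' h + nu' g) * 1 : R).
  by ring.
have /eH e0 : H_ot mu nu (oplus (h - mu' h *: one) (g - nu' g *: one)).
  exists (h - mu' h *: one), (g - nu' g *: one).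
  by split=> //; rewrite dualB dualZ integral_dual_one mulr1 subrr.
by rewrite dualD dualZ e0 add0r mulrC.
Qed.

Lemma pairl_continuous (y : T) : continuous (fun x : S => (x, y)).
Proof. by move=> x; apply: cvg_pair; [exact: cvg_id|exact: cvg_cst]. Qed.

Lemma pairr_continuous (x : S) : continuous (fun y : T => (x, y)).
Proof. by move=> y; apply: cvg_pair; [exact: cvg_cst|exact: cvg_id]. Qed.

(** The products alpha tensor delta_y and delta_x tensor beta make sense even
    when alpha and beta are not measures, because freezing one variable of a
    continuous function leaves a continuous function. *)
Definition tensor_dirac (y : T) : dual Cx -> dual C :=
  pushforward (@pairl_continuous y).
Definition dirac_tensor (x : S) : dual Cy -> dual C :=
  pushforward (@pairr_continuous x).

Lemma tensor_diracE y (a : dual Cx) h g :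
  tensor_dirac y a (oplus h g) = a h + g y * a one.
Proof.
rewrite -[g y * a one]dualZ -dualD.
congr (a _); apply/val_inj/funext => x.
by rewrite -[LHS]/(h x + g y : R) -[RHS]/(h x + g y * 1 : R) mulr1.
Qed.

Lemma dirac_tensorE x (b : dual Cy) h g :
  dirac_tensor x b (oplus h g) = b g + h x * b one.
Proof.
rewrite -[h x * b one]dualZ -dualD.
congr (b _); apply/val_inj/funext => y.
by rewrite -[LHS]/(h x + g y : R) -[RHS]/(g y + h x * 1 : R) mulr1 addrC.
Qed.

(** The first two corrections remove the marginals of eta; each adds a multiple
    of a Dirac mass to the other marginal, which the last term takes away. *)
Lemma Hperp_residual x y eta :
  Hperp (eta - tensor_dirac y (marg1 eta) - dirac_tensor x (marg2 eta)
         + eta one *: point_eval R (x, y)).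
Proof.
move=> _ [h [g [_ _ ->]]].
rewrite 3!dualDE 2!dualNE dualZE tensor_diracE dirac_tensorE marg1_one marg2_one.
rewrite marginalsE -[point_eval R (x, y) _]/(h x + g y : R).
by rewrite /GRing.scale/=; ring.
Qed.

(** A functional with marginals mu and nu, in general not positive. *)
Definition cross_coupling x y : dual C :=
  tensor_dirac y mu' + dirac_tensor x nu' - point_eval R (x, y).

Lemma cross_couplingE x y h g :
  cross_coupling x y (oplus h g) = mu' h + nu' g.
Proof.
rewrite 2!dualDE dualNE tensor_diracE dirac_tensorE !integral_dual_one.
by rewrite -[point_eval R (x, y) _]/(h x + g y : R); ring.
Qed.

Lemma Hperp_cross_coupling x y : Hperp (cross_coupling x y).
Proof. by move=> _ [h [g [h0 g0 ->]]]; rewrite cross_couplingE h0 g0 addr0. Qed.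

(** * Repairing an approximate coupling *)

(** The summands of h (+) g <= u may be very negative, and they are only
    determined up to a constant moved from one to the other. Normalise so that
    sup h = 0; then g <= N with N = |u|. Clipping h below at - 2 N and g below
    at - N changes the sum only where it remains <= - N <= u. *)
Lemma oplus_dominated (u : C) h g :
  (forall p, (oplus h g p : R) <= u p) ->
  exists h' g', [/\ mu' h + nu' g <= mu' h' + nu' g',
    (forall p, (oplus h' g' p : R) <= u p) & `|oplus h' g'| <= 3 * `|u|].
Proof.
move=> hgu; set N := `|u|; have N0 : 0 <= N := normr_ge0 u.
have hg_le x y : h x + g y <= N.
  apply: (le_trans (hgu (x, y))).
  by have := Cb_le_norm u (x, y); rewrite ler_norml => /andP[].
have uN p : - N <= u p by have := Cb_le_norm u p; rewrite ler_norml => /andP[].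
pose A := sup [set (h x : R) | x in [set: S]].
have hA x : h x <= A.
  apply: ub_le_sup; last by exists x.
  exists `|h| => _ [t _ <-].
  by have := Cb_le_norm h t; rewrite ler_norml => /andP[].
have gA y : g y + A <= N.
  rewrite addrC -lerBrDr; apply: ge_sup; first by exists (h point), point.
  by move=> _ [x _ <-]; rewrite lerBrDr.
pose h' := clip (h - A *: one) (- (2 * N)); pose g' := clip (g + A *: one) (- N).
have h'E x : h' x = Num.max (h x - A) (- (2 * N)).
  by rewrite -[LHS]/(Num.max (h x - A * 1 : R) (- (2 * N))) mulr1.
have g'E y : g' y = Num.max (g y + A) (- N).
  by rewrite -[LHS]/(Num.max (g y + A * 1 : R) (- N)) mulr1.
exists h', g'; split.
- have -> : mu' h + nu' g = mu' (h - A *: one) + nu' (g + A *: one).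
    by rewrite dualB dualD !dualZ !integral_dual_one; ring.
  apply: lerD; apply: dual_pos_le => [|x]; try exact: integral_dual_pos.
    by rewrite le_max lexx.
  by rewrite le_max lexx.
- move=> [x y]; rewrite -[leLHS]/(h' x + g' y : R) h'E g'E.
  have /= := hgu (x, y); have := uN (x, y); have := hA x; have := gA y.
  by rewrite /Num.max; case: ifP => _; case: ifP => _; lra.
- apply: Cb_norm_le => [|[x y]]; first by rewrite mulr_ge0.
  rewrite (_ : oplus h' g' (x, y) = h' x + g' y)// h'E g'E.
  have := hA x; have := gA y; rewrite ler_norml /Num.max.
  by case: ltP => ?; case: ltP => ? ? ?; apply/andP; split; lra.
Qed.

(** After the reduction to |h (+) g| <= 3 |u|, replacing n by eta on h (+) g
    costs at most 3 |eta - n| |u|, and eta is monotone. The reduction increases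
    n(h (+) g) because n has nonnegative multiples of mu and nu as marginals. *)
Lemma Hperp_le_dominating eta (n : dual C) (u : C) h g :
  dual_pos eta -> Hperp n -> 0 <= (n one : R) ->
  (forall p, (oplus h g p : R) <= u p) ->
  (n (oplus h g) : R) <= eta u + 3 * `|eta - n| * `|u|.
Proof.
move=> eta0 /annihilator_HotP nE n0 /oplus_dominated[h' [g' [le1 le2 le3]]].
have : n (oplus h g) <= n (oplus h' g') by rewrite !nE ler_wpM2l.
move/le_trans; apply.
have -> : n (oplus h' g') = eta (oplus h' g') - (eta - n) (oplus h' g').
  by rewrite dualDE dualNE; ring.
apply: lerD; first exact: dual_pos_le.
rewrite -mulrA mulrCA lerNl; have := dual_le (eta - n) (oplus h' g').
rewrite ler_norml => /andP[+ _]; apply: le_trans.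
by rewrite lerN2 ler_wpM2l.
Qed.

(** The functional eta' is sought between two constraints: it must agree with n
    on the functions h (+) g, and be dominated by u |-> eta(u) + 3 |eta - n| |u|
    while being positive. The cone G collects these constraints, and
    [Hperp_le_dominating] says that they are consistent. *)
Lemma coupling_repair eta (n : dual C) :
  dual_pos eta -> Hperp n -> 0 <= (n one : R) ->
  exists eta' : dual C, [/\ dual_pos eta', Hperp eta', eta' one = n one
    & `|eta - eta'| <= 3 * `|eta - n|].
Proof.
move=> eta0 nH n0; set e := `|eta - n|.
pose G : set (C * R^o) := [set w | exists h g (u p : C), [/\ Cb_pos p,
  w.1 = oplus h g + u - p & n (oplus h g) + eta u + 3 * e * `|u| <= w.2]].
have e0 : 0 <= e by exact: normr_ge0.
have Goplus h g : G (oplus h g, n (oplus h g)).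
  exists h, g, 0, 0; split=> //=; first by rewrite addr0 subr0.
  by rewrite dual0 normr0 mulr0 !addr0.
have Gu (u : C) : G (u, eta u + 3 * e * `|u|).
  exists 0, 0, u, 0; split=> //=; first by rewrite oplus0 add0r subr0.
  by rewrite oplus0 dual0 add0r.
have Gp (p : C) : Cb_pos p -> G (- p, 0).
  move=> p0; exists 0, 0, 0, p; split=> //=; first by rewrite oplus0 !add0r.
  by rewrite oplus0 !dual0 normr0 mulr0 !addr0.
have [|u|r [h [g [u [p [/= p0 E le]]]]]|eta' eta'G] :=
    @dual_minorant R C G (`|eta| + 3 * e).
- split=> [k [w r] k0|[w r] [w' r']].
    move=> [h [g [u [p [/= p0 -> le]]]]].
    exists (k *: h), (k *: g), (k *: u), (k *: p).
    split=> /=; first by move=> x; rewrite CbZE mulr_ge0.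
      by rewrite oplusZ scalerBr scalerDr.
    rewrite oplusZ !dualZ normrZ ger0_norm// -[_ *: _]/(k * r : R).
    apply: le_trans (ler_wpM2l k0 le).
    by rewrite !mulrDr mulrCA.
  move=> [h [g [u [p [/= p0 -> le]]]]] [h' [g' [u' [p' [/= p'0 -> le']]]]].
  exists (h + h'), (g + g'), (u + u'), (p + p').
  split=> /=; first by move=> x; rewrite CbDE addr_ge0.
    by rewrite oplusD opprD addrACA (addrACA (oplus h g)).
  rewrite oplusD !dualD; have := ler_wpM2l (mulr_ge0 (ler0n R 3) e0) (ler_normD u u').
  by move: le le'; lra.
- exists (eta u + 3 * e * `|u|) => //.
  rewrite [leRHS]mulrDl lerD2r (le_trans (ler_norm _))//; exact: dual_le.
- apply: le_trans le.
  have := @Hperp_le_dominating eta n u (- h) (- g) eta0 nH n0.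
  rewrite oplusN dualN -/e => H.
  suff /H : forall q, ((- oplus h g) q : R) <= u q by lra.
  move=> q; rewrite CbNE -subr_ge0 opprK -CbDE addrC.
  have -> : oplus h g + u = p by apply/eqP; rewrite -subr_eq0 -E.
  exact: p0.
have eta'oplus h g : eta' (oplus h g) = n (oplus h g).
  apply: le_anti; rewrite eta'G//=.
  by have := eta'G _ _ (Goplus (- h) (- g)); rewrite oplusN !dualN lerN2.
exists eta'; split.
- by move=> p /Gp/eta'G; rewrite dualN oppr_le0.
- by move=> f Hf; have := nH _ Hf; have [h [g [_ _ ->]]] := Hf; rewrite eta'oplus.
- by rewrite -(marg1_one eta') -(marg1_one n); exact: eta'oplus.
- apply: supn_le => [|u /= u1]; first by rewrite mulr_ge0.
  have le1 (v : C) : (eta' - eta) v <= 3 * e * `|v|.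
    by have := eta'G _ _ (Gu v); rewrite dualDE dualNE; lra.
  have {}u1 : 3 * e * `|u| <= 3 * e by rewrite ler_piMr// mulr_ge0.
  have := le1 u; have := le1 (- u).
  rewrite normrN dualN dualDE dualNE => l1 l2.
  rewrite -[X in `|X|]/(eta u - eta' u : R) ler_norml.
  by apply/andP; split; lra.
Qed.

(** Repairing the zero functional towards [cross_coupling] gives a coupling
    without forming a product measure. *)
Lemma Qot_nonempty : Q_ot mu nu !=set0.
Proof.
have zero_pos : dual_pos (0 : dual C) by [].
have E : cross_coupling point point one = 1.
  rewrite -marg1_one -[LHS]/(cross_coupling point point (oplus one 0)).
  by rewrite cross_couplingE integral_dual_one dual0 addr0.
have [||eta [eta0 etaH eta1 _]] :=
    @coupling_repair 0 (cross_coupling point point) zero_pos.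
- exact: Hperp_cross_coupling.
- by rewrite E ler01.
by exists eta; split=> //; rewrite eta1.
Qed.

(** * Decomposition of the biannihilator and of the polar cone *)

Local Notation BC := (Minkowski_sum (frakB mu) (frakC nu)).

Lemma bioplus_split (b : bidual Cx) (c : bidual Cy) :
  bioplus b c = bioplus b 0 + bioplus 0 c :> bidual C.
Proof.
apply/val_inj/funext => eta.
rewrite -[RHS]/((b (marg1 eta) + 0) + (0 + c (marg2 eta)) : R) addr0 add0r.
by [].
Qed.

(** Since [bioplus] is additive, B + C consists of single sums b (+) c. *)
Lemma BCP (z : bidual C) : BC z <->
  exists (b : bidual Cx) (c : bidual Cy), [/\ b mu' = 0, c nu' = 0 & z = bioplus b c].
Proof.
split=> [[_ [b b0 <-] [_ [c c0 <-] <-]]|[b [c [b0 c0 ->]]]].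
  by exists b, c; split=> //; rewrite [RHS]bioplus_split.
by exists (bioplus b 0); [exists b|exists (bioplus 0 c); [exists c|]];
  rewrite // -bioplus_split.
Qed.

Lemma Hperp_marginals (n : dual C) : Hperp n ->
  marg1 n = n one *: mu' /\ marg2 n = n one *: nu'.
Proof.
move=> /annihilator_HotP nE; apply: marginals_eq => h g.
by rewrite nE !dualZE mulrDr.
Qed.

(** An element z of frakH_ot vanishes on the residuals of [Hperp_residual], so it
    acts on eta through b = z(. tensor delta_y) and c = z(delta_x tensor .), up
    to a multiple of eta(1). Vanishing on [cross_coupling] identifies this
    multiple as b(mu) + c(nu), which is what normalising b and c subtracts. *)
Lemma frakH_decomposition : frakH_ot mu nu = BC.
Proof.
apply/seteqP; split=> [z zH|z /BCP[b [c [b0 c0 ->]]] n /Hperp_marginals[n1 n2]]; last first.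
  by rewrite -[LHS]/(b (marg1 n) + c (marg2 n)) n1 n2 !dualZ b0 c0 !mulr0 addr0.
pose x : S := point; pose y : T := point.
pose b := adjoint (@pushforward_linear R _ _ _ (@pairl_continuous y))
                  (@pushforward_contraction R _ _ _ (@pairl_continuous y)) z.
pose c := adjoint (@pushforward_linear R _ _ _ (@pairr_continuous x))
                  (@pushforward_contraction R _ _ _ (@pairr_continuous x)) z.
have bE a : b a = z (tensor_dirac y a) by [].
have cE a : c a = z (dirac_tensor x a) by [].
have zcross : b mu' + c nu' = z (point_eval R (x, y)).
  apply/eqP; rewrite -subr_eq0 bE cE -dualD -dualB; apply/eqP.
  by apply: zH; exact: Hperp_cross_coupling.
apply/BCP; exists (b - b mu' *: bidual_embed one), (c - c nu' *: bidual_embed one).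
split.
- by rewrite dualDE dualNE dualZE [bidual_embed _ _]integral_dual_one mulr1 subrr.
- by rewrite dualDE dualNE dualZE [bidual_embed _ _]integral_dual_one mulr1 subrr.
apply/val_inj/funext => eta.
have := zH _ (Hperp_residual x y eta).
rewrite dualD 2!dualB dualZ -bE -cE -zcross => e0.
have zE : z eta = b (marg1 eta) + c (marg2 eta) - eta one * (b mu' + c nu') :> R.
  by apply/eqP; rewrite -subr_eq0 -e0; apply/eqP; ring.
rewrite [LHS]zE -[RHS]/((b (marg1 eta) - b mu' * marg1 eta one) +
                        (c (marg2 eta) - c nu' * marg2 eta one) : R).
by rewrite marg1_one marg2_one; ring.
Qed.

(** The positive elements of the annihilator are the nonnegative multiples of those
    of Q_ot: one of
    zero mass is zero, by [dual_pos_norm]. *)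
Lemma frakK_homogeneous (z : bidual C) eta :
  frakK_ot mu nu z -> dual_pos eta -> Hperp eta -> (z eta : R) <= 0.
Proof.
move=> zK eta0 etaH; have := dual_pos_norm eta0.
have [e0|en0] := eqVneq (eta one : R) 0.
  by rewrite e0 normr_le0 => /eqP ->; rewrite dual0.
move=> /(le_trans (normr_ge0 _)) e0.
have ep : 0 < eta one by rewrite lt_def en0.
have : (z ((eta one)^-1 *: eta) : R) <= 0.
  apply: zK; split.
  - by move=> f f0; rewrite dualZE mulr_ge0 ?invr_ge0//; exact: eta0.
  - by rewrite dualZE mulVf.
  - by move=> f Hf; rewrite dualZE (etaH _ Hf) mulr0.
by rewrite dualZ pmulr_rle0// invr_gt0.
Qed.

(** If n(1) >= 0, compare eta with its repair, on which z is nonpositive. If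
    n(1) < 0, then eta itself is small: |eta| = eta(1) <= (eta - n)(1). *)
Lemma frakK_bound (z : bidual C) eta (n : dual C) :
  frakK_ot mu nu z -> dual_pos eta -> Hperp n ->
  (z eta : R) <= 3 * `|z| * `|eta - n|.
Proof.
move=> zK eta0 nH; have z_le k : z k <= `|z| * `|k|.
  by rewrite (le_trans (ler_norm _))//; exact: dual_le.
have [n0|n0] := leP 0 (n one : R).
  have [eta' [eta'0 eta'H _ close]] := coupling_repair eta0 nH n0.
  have -> : z eta = z eta' + z (eta - eta') by rewrite dualB addrC subrK.
  rewrite -[leRHS]add0r; apply: lerD; first exact: frakK_homogeneous.
  by rewrite (le_trans (z_le _))// -mulrA mulrCA ler_wpM2l.
have le : `|eta| <= `|eta - n|.
  apply: (le_trans (dual_pos_norm eta0)).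
  have one1 : `|one : C| <= 1 by apply: Cb_norm_le => // p; rewrite normr1.
  apply: (@le_trans _ _ ((eta - n) one)); first by rewrite dualDE dualNE; lra.
  rewrite (le_trans (ler_norm _))// (le_trans (dual_le _ _))//.
  by rewrite ler_piMr.
apply: (le_trans (z_le _)).
have := ler_wpM2l (normr_ge0 z) le.
have := mulr_ge0 (normr_ge0 z) (normr_ge0 (eta - n)); lra.
Qed.

(** The cone G encodes, for a functional l of norm at most K, that l <= 0 on
    the annihilator of H_ot, hence l = 0 there since it is a subspace, and that
    l >= z on positive functionals; [frakK_bound] makes it proper. *)
Lemma frakK_majorant (z : bidual C) : frakK_ot mu nu z ->
  exists2 l, frakH_ot mu nu l & forall eta, dual_pos eta -> (z eta : R) <= l eta.
Proof.
move=> zK; set K := 3 * `|z|; have K0 : 0 <= K by rewrite mulr_ge0.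
pose G : set (dual C * R^o) := [set w | exists n xi eta : dual C,
  [/\ Hperp n, dual_pos eta, w.1 = n + xi - eta & K * `|xi| - z eta <= w.2]].
have H0 : Hperp 0 by [].
have P0 : @dual_pos R (S * T)%type 0 by [].
have [|xi|r [n [xi [eta [/= nH eta0 E le]]]]|l lG] := @dual_minorant R (dual C) G K.
- split=> [k [w r] k0|[w r] [w' r']].
    move=> [n [xi [eta [/= nH eta0 -> le]]]].
    exists (k *: n), (k *: xi), (k *: eta); split=> /=.
    + by move=> f Hf; rewrite dualZE (nH _ Hf) mulr0.
    + by move=> f f0; rewrite dualZE mulr_ge0//; exact: eta0.
    + by rewrite scalerBr scalerDr.
    rewrite dualZ normrZ ger0_norm// -[_ *: _]/(k * r : R).
    by apply: le_trans (ler_wpM2l k0 le); rewrite mulrBr mulrCA.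
  move=> [n [xi [eta [/= nH eta0 -> le]]]] [n' [xi' [eta' [/= n'H eta'0 -> le']]]].
  exists (n + n'), (xi + xi'), (eta + eta'); split=> /=.
  + by move=> f Hf; rewrite dualDE (nH _ Hf) (n'H _ Hf) addr0.
  + by move=> f f0; rewrite dualDE addr_ge0//; [exact: eta0|exact: eta'0].
  + by rewrite opprD addrACA (addrACA n).
  rewrite dualD; have := ler_wpM2l K0 (ler_normD xi xi').
  by move: le le'; lra.
- exists (K * `|xi|) => //; exists 0, xi, 0.
  by split=> //=; rewrite ?add0r ?subr0// dual0 subr0.
- apply: le_trans le; rewrite subr_ge0.
  have -> : xi = eta - n.
    by apply/eqP; rewrite -subr_eq0 opprB addrA (addrC xi) -E.
  exact: frakK_bound.
have ln n : Hperp n -> l n <= 0.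
  move=> nH; apply: lG; exists n, 0, 0; split=> //=; first by rewrite addr0 subr0.
  by rewrite normr0 mulr0 dual0 subr0.
exists l => [n nH|eta eta0].
  apply: le_anti; rewrite ln//= -oppr_le0 -dualN; apply: ln => f Hf.
  by rewrite dualNE (nH _ Hf) oppr0.
rewrite -lerN2 -dualN; apply: lG; exists 0, 0, eta; split=> //=.
  by rewrite !add0r.
by rewrite normr0 mulr0 add0r.
Qed.

Lemma frakK_decomposition : frakK_ot mu nu = Minkowski_sum BC bidual_neg.
Proof.
rewrite -frakH_decomposition; apply/seteqP; split=> [z /frakK_majorant[l lH zl]|].
  exists l => //; exists (z - l); last by rewrite addrC subrK.
  by move=> eta eta0; rewrite opprB dualDE dualNE subr_ge0 zl.
move=> _ [l lH [z z0 <-]] eta [eta0 _ etaH].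
rewrite dualDE (lH _ etaH) add0r -oppr_ge0 -dualNE; exact: z0.
Qed.

(** * Attainment in the dual problem *)

(** Both D_inf and the dual values are governed by the same condition, that
    a - c I(1) lies in frakK_ot; the least such c is the supremum of a on Q_ot,
    which is finite because functionals in Q_ot have norm at most 1. *)
Lemma dual_attainment (a : bidual C) : exists m : R,
  [/\ D_inf a (frakK_ot mu nu) = m%:E,
      is_minimum (dual_values mu nu a) m
    & m%:E = ereal_sup [set (a eta : R)%:E | eta in Q_ot mu nu]].
Proof.
have Q1 eta : Q_ot mu nu eta -> (a eta : R) <= `|a|.
  move=> [eta0 eta1 _]; rewrite (le_trans (ler_norm _))// (le_trans (dual_le _ _))//.
  by rewrite ler_piMr// (le_trans (dual_pos_norm eta0))// eta1.
pose A := [set (a eta : R) | eta in Q_ot mu nu].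
have A0 : A !=set0 by have [eta Qeta] := Qot_nonempty; exists (a eta), eta.
have supA : has_sup A by split=> //; exists `|a| => _ [eta /Q1 ? <-].
have embE eta c : (c *: bidual_embed one) eta = c * eta one :> R by [].
pose m := sup A.
have mK : frakK_ot mu nu (a - m *: bidual_embed one).
  move=> eta Qeta; have [_ eta1 _] := Qeta.
  rewrite dualDE dualNE embE eta1 mulr1 subr_le0.
  by apply: ub_le_sup; [exact: supA.2|exists eta].
have sup_le (c : R) : (forall eta, Q_ot mu nu eta -> (a eta : R) <= c) -> m <= c.
  by move=> ac; apply: ge_sup => // _ [eta /ac ? <-].
exists m; split.
- apply/le_anti/andP; split.
    apply: ereal_inf_lbound; exists m => //.
    by exists (a - m *: bidual_embed one); rewrite // addrC subrK.
  apply/ereal_infP => _ [c [z zK aE] <-]; rewrite lee_fin.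
  apply: sup_le => eta Qeta; have [_ eta1 _] := Qeta.
  by rewrite -aE dualDE embE eta1 mulr1 gerDl zK.
- split.
    move: mK; rewrite frakK_decomposition => -[_ /BCP[b [c [b0 c0 ->]]] [z z0 E]].
    exists b, c; split=> // eta eta0.
    have aE : a = (m *: bidual_embed one + bioplus b c) + z.
      by rewrite -addrA E addrC subrK.
    by rewrite aE opprD addrA subrr add0r; exact: z0.
  move=> c [b [c' [b0 c'0 le]]]; apply: sup_le => eta Qeta.
  have [eta0 eta1 etaH] := Qeta; have := le _ eta0.
  have BCbc : frakH_ot mu nu (bioplus b c') by rewrite frakH_decomposition; apply/BCP; exists b, c'.
  by rewrite dualDE dualNE dualDE embE eta1 mulr1 BCbc// addr0 subr_ge0.
- rewrite -(image_comp (fun eta => a eta : R) EFin) ereal_sup_EFin//.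
  exact: supA.2.
Qed.

End optimal_transport.

Theorem proposition5p4 (R : realType) (d : nat) (X Y : set 'rV[R]_d)
    (X0 : X !=set0) (Y0 : Y !=set0) (clX : closed X) (clY : closed Y)
    (mu : probability (borel (subspace_of X0)) R)
    (nu : probability (borel (subspace_of Y0)) R) :
  [/\ frakH_ot mu nu = Minkowski_sum (frakB mu) (frakC nu),
      frakK_ot mu nu = Minkowski_sum (Minkowski_sum (frakB mu) (frakC nu)) bidual_neg,
      Minkowski_sum (Minkowski_sum (frakB mu) (frakC nu)) bidual_neg =
        Minkowski_sum (frakH_ot mu nu) bidual_neg
    & forall a : bidual (Cb R (subspace_of X0 * subspace_of Y0)%type),
        D_inf a (frakK_ot mu nu) =
          D_inf a (Minkowski_sum (Minkowski_sum (frakB mu) (frakC nu)) bidual_neg) /\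
        exists m : R,
          [/\ D_inf a (Minkowski_sum (Minkowski_sum (frakB mu) (frakC nu)) bidual_neg) = m%:E,
              is_minimum (dual_values mu nu a) m
            & m%:E = ereal_sup [set (a eta : R)%:E | eta in Q_ot mu nu]]].
Proof.
split; [exact: frakH_decomposition|exact: frakK_decomposition|by rewrite frakH_decomposition|move=> a].
by rewrite -frakK_decomposition; split; last exact: dual_attainment.
Qed.
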